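(* Suppose the plant graph $G_{\mathcal P}$ contains no isolated node and the control graph satisfies $G_{\mathcal K}\supseteq G_{\mathcal P}$. Then the competitive ratio of the deadbeat control design method $\Gamma^{\Delta}(A,B)=-B^{-1}A$ is $$r_{\mathcal P}(\Gamma^{\Delta})=1+\frac{1}{\epsilon^2}.$$
   Context: Fix integers $q\ge 1$ and $n_1,\dots,n_q\ge 1$, put $n=\sum_{i=1}^q n_i$, and fix a real $\epsilon>0$. Matrices $M\in\mathbb R^{n\times n}$ are partitioned into blocks $M_{ij}\in\mathbb R^{n_i\times n_j}$, $1\le i,j\le q$. Graphs are directed with vertex set $\{1,\dots,q\}$, possibly with self-loops. The adjacency matrix $S=(s_{ij})$ of $G=(\{1,\dots,q\},E)$ is $s_{ij}=1$ if $(j,i)\in E$ and $s_{ij}=0$ otherwise. $G'\supseteq G$ means the edge set of $G'$ contains that of $G$. A vertex $i$ is isolated if there is no $j\ne i$ with $(i,j)\in E$ or $(j,i)\in E$. Plants: given the plant graph $G_{\mathcal P}$ with adjacency matrix $S_{\mathcal P}$, let $\mathcal A(S_{\mathcal P})=\{A\in\mathbb R^{n\times n}: A_{ij}=0 \text{ whenever } (s_{\mathcal P})_{ij}=0\}$, and let $\mathcal B(\epsilon)$ be the set of diagonal $n\times n$ matrices with all diagonal entries $\ge\epsilon$. The set of plants is $\mathcal P=\mathcal A(S_{\mathcal P})\times\mathcal B(\epsilon)\times\mathbb R^n$; $P=(A,B,x_0)$ stands for the system $x(k+1)=Ax(k)+Bu(k)$, $x(0)=x_0$. Controllers: given the control graph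 $G_{\mathcal K}$ with adjacency matrix $S_{\mathcal K}$, let $\mathcal K=\{K\in\mathbb R^{n\times n}: K_{ij}=0 \text{ whenever } (s_{\mathcal K})_{ij}=0\}$; $K$ acts by $u(k)=Kx(k)$. Cost: $J_P(K)=\sum_{k=1}^\infty x(k)^Tx(k)+\sum_{k=0}^\infty u(k)^Tu(k)\in[0,\infty]$, evaluated along the closed loop of $P$ with $u=Kx$. Competitive ratio: it is assumed that for every $P\in\mathcal P$ there is an optimal controller $K^*(P)\in\mathcal K$, i.e. $J_P(K^*(P))\le J_P(K)$ for all $K\in\mathcal K$. For a control design method, i.e. a map $\Gamma:\mathcal A(S_{\mathcal P})\times\mathcal B(\epsilon)\to\mathcal K$, set $$r_{\mathcal P}(\Gamma)=\sup_{P=(A,B,x_0)\in\mathcal P}\frac{J_P(\Gamma(A,B))}{J_P(K^*(P))},$$ with the conventions $0/0=1$ and $c/0=\infty$ for $c>0$. *)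

(* Defs.v *)
From HB Require Import structures.
From mathcomp Require Import all_boot all_order all_algebra.
From mathcomp Require Import all_classical all_reals all_analysis.

Set Implicit Arguments.
Unset Strict Implicit.
Unset Printing Implicit Defensive.

Import Order.TTheory GRing.Theory Num.Theory.

Local Open Scope classical_set_scope.
Local Open Scope ring_scope.

(* A digraph on 'I_q is its edge set; (i, j) \in E is an edge from i to j. *)
Definition digraph (q : nat) : predArgType := {set 'I_q * 'I_q}.

Definition adjmx (q : nat) (E : digraph q) : 'M[nat]_q :=
  \matrix_(i, j) ((j, i) \in E : nat).

Definition isolated_vertex (q : nat) (E : digraph q) (i : 'I_q) : bool :=
  ~~ [exists j : 'I_q, (j != i) && (((i, j) \in E) || ((j, i) \in E))].

(* Both the plant set A(S_P) and the controller set K are of this form. *)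
Definition structured (R : realType) (q : nat) (n_ : 'I_q -> nat)
    (S : 'M[nat]_q) : set 'M[R]_(\sum_(i < q) n_ i) :=
  [set M | forall i j : 'I_q, S i j = 0%N -> submxblock M i j = 0].

Definition diag_ge (R : realType) (n : nat) (eps : R) : set 'M[R]_n :=
  [set B | is_diag_mx B /\ forall i : 'I_n, eps <= B i i].

Arguments structured {R q} n_ S _.

(* A plant ((A, B), x0). *)
Definition plant (R : realType) (n : nat) : Type :=
  ('M[R]_n * 'M[R]_n * 'cV[R]_n)%type.

Definition plants (R : realType) (q : nat) (n_ : 'I_q -> nat)
    (EP : digraph q) (eps : R) : set (plant R (\sum_(i < q) n_ i)) :=
  (structured n_ (adjmx EP) `*` diag_ge eps) `*` setT.

Arguments plants {R q} n_ EP eps _.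

Fixpoint state (R : realType) (n : nat) (P : plant R n) (K : 'M[R]_n)
    (k : nat) : 'cV[R]_n :=
  let: (A, B, x0) := P in
  if k is k'.+1 then A *m state P K k' + B *m (K *m state P K k') else x0.

Definition input (R : realType) (n : nat) (P : plant R n) (K : 'M[R]_n)
    (k : nat) : 'cV[R]_n :=
  K *m state P K k.

Definition sqnorm (R : realType) (n : nat) (v : 'cV[R]_n) : R :=
  (v^T *m v) 0 0.

Definition cost (R : realType) (n : nat) (P : plant R n) (K : 'M[R]_n) :
    \bar R :=
  (\sum_(1 <= k <oo) (sqnorm (state P K k))%:E
   + \sum_(0 <= k <oo) (sqnorm (input P K k))%:E)%E.

(* An optimal controller is relative to the initial state, which is part of
   the plant. *)
Definition optimal (R : realType) (q : nat) (n_ : 'I_q -> nat)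
    (EK : digraph q) (P : plant R (\sum_(i < q) n_ i))
    (K : 'M[R]_(\sum_(i < q) n_ i)) : Prop :=
  structured n_ (adjmx EK) K /\
  forall K' : 'M[R]_(\sum_(i < q) n_ i),
    structured n_ (adjmx EK) K' -> (cost P K <= cost P K')%E.

(* Quotient of costs in [0, +oo], with 0 / 0 = 1 and c / 0 = +oo for c > 0.
   The value of c / +oo is the library's, which is 0 even for c = +oo. *)
Definition cost_ratio (R : realType) (c d : \bar R) : \bar R :=
  (if d == 0 then (if c == 0 then 1 else +oo) else c / d)%E.

(* Values of the function outside A(S_P) x B(eps) are irrelevant. *)
Record design_method (R : realType) (q : nat) (n_ : 'I_q -> nat)
    (EP EK : digraph q) (eps : R) : Type := DesignMethod {
  design_fun :> 'M[R]_(\sum_(i < q) n_ i) -> 'M[R]_(\sum_(i < q) n_ i) ->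
                'M[R]_(\sum_(i < q) n_ i);
  design_structured :
    forall A B : 'M[R]_(\sum_(i < q) n_ i),
      structured n_ (adjmx EP) A -> diag_ge eps B ->
      structured n_ (adjmx EK) (design_fun A B) }.

Definition competitive_ratio (R : realType) (q : nat) (n_ : 'I_q -> nat)
    (EP EK : digraph q) (eps : R)
    (Kstar : plant R (\sum_(i < q) n_ i) -> 'M[R]_(\sum_(i < q) n_ i))
    (Gamma : design_method n_ EP EK eps) : \bar R :=
  ereal_sup [set cost_ratio (cost P (Gamma P.1.1 P.1.2)) (cost P (Kstar P))
            | P in plants n_ EP eps].

Lemma deadbeat_structured (R : realType) (q : nat) (n_ : 'I_q -> nat)
    (EP EK : digraph q) (eps : R) (heps : 0 < eps) (hsub : EP \subset EK)
    (A B : 'M[R]_(\sum_(i < q) n_ i)) :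
  structured n_ (adjmx EP) A -> diag_ge eps B ->
  structured n_ (adjmx EK) (- (invmx B *m A)).
Proof.
move=> hA [/is_diag_mxP dB gB] i j hij.
have {}hij : adjmx EP i j = 0%N.
  move: hij; rewrite !mxE.
  by case: (boolP ((j, i) \in EP)) => // /(fintype.subsetP hsub) ->.
have {}hA := hA i j hij.
have Bn0 k : B k k != 0 by rewrite gt_eqF// (lt_le_trans heps (gB k)).
pose D : 'M[R]_(\sum_(i < q) n_ i) := diag_mx (\row_k (B k k)^-1).
have DB : D *m B = 1%:M.
  apply/matrixP => k l; rewrite mul_diag_mx !mxE.
  have [<-|kl] := eqVneq k l; first by rewrite mulVf.
  by rewrite (dB k l kl) mulr0.
have Bu : B \in unitmx by case: (mulmx1_unit DB).
have -> : invmx B = D by rewrite -[RHS]mulmx1 -(mulmxV Bu) mulmxA DB mul1mx.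
apply/matrixP => k l; rewrite mul_diag_mx !mxE.
by move/matrixP/(_ k l): hA; rewrite !mxE => ->; rewrite mulr0 oppr0.
Qed.

Definition deadbeat (R : realType) (q : nat) (n_ : 'I_q -> nat)
    (EP EK : digraph q) (eps : R) (heps : 0 < eps) (hsub : EP \subset EK) :
    design_method n_ EP EK eps :=
  @DesignMethod R q n_ EP EK eps (fun A B => - (invmx B *m A))
    (deadbeat_structured heps hsub).

(* Main.v *)
(* Deadbeat control brings the state to 0 in one step, at the cost [|z|^2] of
   the input [u(0) = - z], [z = B^-1 A x0].  Any controller pays at least
   [|x(1)|^2 + |u(0)|^2] with [x(1) = B (z + u(0))]; as B is diagonal, a
   coordinatewise optimization shows that this is at least
   [|z|^2 / (1 + 1 / eps^2)].  The bound is attained by [B = eps I] and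
   [A = e_a e_b^T], where a and b lie in the blocks of the two ends of an edge
   that is not a loop: A is nilpotent, so the best first input also ends the
   process at time 1. *)
Require Import Defs.
From HB Require Import structures.
From mathcomp Require Import all_boot all_order all_algebra.
From mathcomp Require Import all_classical all_reals all_analysis.
From mathcomp Require Import ring lra.

Set Implicit Arguments.
Unset Strict Implicit.
Unset Printing Implicit Defensive.

Import Order.TTheory GRing.Theory Num.Theory.

Local Open Scope classical_set_scope.
Local Open Scope ring_scope.

Section QuadraticCost.
Context (R : realType) (n : nat).
Implicit Types (A B K : 'M[R]_n) (v : 'cV[R]_n) (P : plant R n).

Lemma sqnormE v : sqnorm v = \sum_i v i 0 ^+ 2.
Proof. by rewrite /sqnorm mxE; apply: eq_bigr => i _; rewrite mxE expr2. Qed.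

Lemma sqnorm_ge0 v : 0 <= sqnorm v.
Proof. by rewrite sqnormE sumr_ge0// => i _; rewrite sqr_ge0. Qed.

Lemma sqnorm0 : sqnorm (0 : 'cV[R]_n) = 0.
Proof. by rewrite /sqnorm mulmx0 mxE. Qed.

Lemma sqnormN v : sqnorm (- v) = sqnorm v.
Proof. by rewrite !sqnormE; apply: eq_bigr => i _; rewrite mxE sqrrN. Qed.

Lemma sqnorm_scale_delta (c : R) (a : 'I_n) :
  sqnorm (c *: delta_mx a 0) = c ^+ 2.
Proof.
rewrite sqnormE (bigD1 a)//= big1 => [|i /negbTE ia]; rewrite !mxE ?eqxx ?ia.
  by rewrite mulr1 addr0.
by rewrite mulr0 expr0n.
Qed.

Lemma diag_ge_unitmx (eps : R) B :
  0 < eps -> diag_ge eps B -> B \in unitmx.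
Proof.
move=> eps0 [dB gB]; case/diag_mxP: dB gB => d -> gB.
rewrite unitmxE det_diag unitfE; apply/prodf_neq0 => i _.
by have := gB i; rewrite mxE eqxx mulr1n => /(lt_le_trans eps0)/lt0r_neq0.
Qed.

Lemma diag_mulmx_col B v i : is_diag_mx B -> (B *m v) i 0 = B i i * v i 0.
Proof.
by case/diag_mxP => d ->; rewrite mul_diag_mx !mxE eqxx mulr1n.
Qed.

Lemma stateS A B x0 K k (P := (A, B, x0)) :
  state P K k.+1 = A *m state P K k + B *m input P K k.
Proof. by []. Qed.

Lemma costE P K :
  (cost P K =
     (sqnorm (state P K 1) + sqnorm (input P K 0))%:E +
     (\sum_(2 <= k <oo) (sqnorm (state P K k))%:E +
      \sum_(1 <= k <oo) (sqnorm (input P K k))%:E))%E.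
Proof.
rewrite /cost EFinD addeACA; congr (_ + _)%E;
rewrite (nneseries_split _ 1) ?big_nat1// => k _; by rewrite lee_fin sqnorm_ge0.
Qed.

Lemma cost_ge_first P K :
  ((sqnorm (state P K 1) + sqnorm (input P K 0))%:E <= cost P K)%E.
Proof.
rewrite costE leeDl// adde_ge0// nneseries_ge0// => k _ _;
by rewrite lee_fin sqnorm_ge0.
Qed.

(** When $A$ and $K$ both kill $x(1)$, the input $u(1)$ and the state $x(2)$ vanish, and so does
    everything later. This covers deadbeat control, where $x(1) = 0$, and the nilpotent extremal
    plant. *)
Lemma cost_terminal A B x0 K (P := (A, B, x0)) :
  A *m state P K 1 = 0 -> K *m state P K 1 = 0 ->
  cost P K = (sqnorm (state P K 1) + sqnorm (input P K 0))%:E.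
Proof.
move=> A1 K1.
have s2 k : state P K k.+2 = 0.
  elim: k => [|k IHk]; rewrite stateS /input ?A1 ?K1 ?IHk;
  by rewrite !mulmx0 addr0.
rewrite costE !eseries0 ?adde0//.
- by case=> // k _ _; rewrite /input; case: k => [|k];
    rewrite ?K1 ?s2 ?mulmx0 sqnorm0.
- by case=> [|[|k]]// _ _; rewrite s2 sqnorm0.
Qed.

Lemma cost_deadbeat (eps : R) A B x0 : 0 < eps -> diag_ge eps B ->
  cost (A, B, x0) (- (invmx B *m A)) = (sqnorm (invmx B *m A *m x0))%:E.
Proof.
move=> eps0 /(diag_ge_unitmx eps0) Bu.
have s1 : state (A, B, x0) (- (invmx B *m A)) 1 = 0.
  by rewrite /= mulNmx mulmxN -mulmxA mulKVmx// subrr.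
rewrite cost_terminal s1 ?mulmx0// sqnorm0 add0r /input/=.
by rewrite mulNmx sqnormN.
Qed.

(** The right-hand side grows with [b], so the case [b = e] suffices; there the minimum over [u] of
    $(e(z+u))^2 + u^2$ is $z^2 / (1 + 1/e^2)$. *)
Lemma sqr_le_one_step (e b z u : R) : 0 < e -> e <= b ->
  z ^+ 2 <= (1 + 1 / e ^+ 2) * ((b * (z + u)) ^+ 2 + u ^+ 2).
Proof.
move=> e0 eb.
have eb2 : (e * (z + u)) ^+ 2 <= (b * (z + u)) ^+ 2.
  by rewrite !exprMn ler_wpM2r ?sqr_ge0// lerXn2r// nnegrE; lra.
have c0 : 0 <= 1 + 1 / e ^+ 2 by rewrite addr_ge0// divr_ge0// sqr_ge0.
apply: (@le_trans _ _ ((1 + 1 / e ^+ 2) * ((e * (z + u)) ^+ 2 + u ^+ 2))).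
  rewrite -subr_ge0.
  (* The defect is a perfect square, zero exactly at the minimizer $u = - e^2 z / (1 + e^2)$. *)
  suff -> : (1 + 1 / e ^+ 2) * ((e * (z + u)) ^+ 2 + u ^+ 2) - z ^+ 2 =
            (e * (z + u) + u / e) ^+ 2 by rewrite sqr_ge0.
  by field; rewrite gt_eqF.
by rewrite ler_wpM2l// lerD2r.
Qed.

Lemma cost_deadbeat_le (eps : R) A B x0 K : 0 < eps -> diag_ge eps B ->
  (cost (A, B, x0) (- (invmx B *m A)) <=
   (1 + 1 / eps ^+ 2)%:E * cost (A, B, x0) K)%E.
Proof.
move=> eps0 hB; have Bu := diag_ge_unitmx eps0 hB.
have c0 : 0 <= 1 + 1 / eps ^+ 2 by rewrite addr_ge0// divr_ge0// sqr_ge0.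
rewrite (cost_deadbeat _ _ eps0 hB).
apply: (le_trans _ (lee_wpmul2l _ (cost_ge_first _ K))); last first.
  by rewrite lee_fin.
rewrite -EFinM lee_fin; set z := _ *m x0; set u := input _ _ _.
(* $A x_0 = B z$ because $z = B^{-1} A x_0$. *)
have -> : state (A, B, x0) K 1 = B *m (z + u).
  by rewrite mulmxDr /z -mulmxA mulKVmx.
move: z u => z u; rewrite !sqnormE -big_split/= mulr_sumr; apply: ler_sum => i _.
case: hB => dB gB; rewrite diag_mulmx_col// mxE; exact: sqr_le_one_step.
Qed.

End QuadraticCost.

(** If [d = 0] then [c = 0] as well, and [1 <= M] absorbs the convention $0/0 = 1$. *)
Lemma cost_ratio_le (R : realType) (c d M : R) : 1 <= M -> 0 <= c -> 0 <= d ->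
  c <= M * d -> (cost_ratio c%:E d%:E <= M%:E)%E.
Proof.
move=> M1 c0 d0 cd; rewrite /cost_ratio !eqe.
have [d0'|dn0] := eqVneq d 0.
  by rewrite ifT ?lee_fin// eq_le c0 andbT -(mulr0 M) -d0'.
by rewrite inver (negbTE dn0) -EFinM lee_fin ler_pdivrMr// lt0r dn0.
Qed.

Lemma cost_ratio_ge (R : realType) (c d M : R) : 0 < c -> 0 <= d ->
  M * d <= c -> (M%:E <= cost_ratio c%:E d%:E)%E.
Proof.
move=> c0 d0 cd; rewrite /cost_ratio !eqe (gt_eqF c0).
have [_|dn0] := eqVneq d 0; first by rewrite leey.
by rewrite inver (negbTE dn0) -EFinM lee_fin ler_pdivlMr// lt0r dn0.
Qed.

Section SingleEdge.
Context (R : realType) (q : nat) (n_ : 'I_q -> nat).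

(** The only nonzero entry lies in block $(i, j)$, which the edge from [j] to [i] frees. This serves
    both the extremal plant and its competing controller. *)
Lemma structured_scale_delta (E : digraph q) (i j : 'I_q) (k : 'I_(n_ i))
    (l : 'I_(n_ j)) (c : R) : (j, i) \in E ->
  structured n_ (adjmx E)
    (c *: delta_mx (tagnat.Rank i k) (tagnat.Rank j l)).
Proof.
move=> jiE i' j' S0; apply/matrixP => k' l'; rewrite !mxE.
case: eqP => [ei|_]; last by rewrite mulr0.
case: eqP => [ej|_]; last by rewrite mulr0.
have ei' : i' = i by rewrite -(tagnat.Rank1K k') ei tagnat.Rank1K.
have ej' : j' = j by rewrite -(tagnat.Rank1K l') ej tagnat.Rank1K.
by move: S0; rewrite ei' ej' mxE jiE.
Qed.

(** From $e_b$ the input is $c e_a$ and the next state $(1 + e c) e_a$, which $e_a e_b^T$ kills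
    since $a \ne b$. *)
Lemma cost_single_edge (n : nat) (a b : 'I_n) (e c : R) : a != b ->
  cost (delta_mx a b, e%:M, delta_mx b 0) (c *: delta_mx a b) =
  ((1 + e * c) ^+ 2 + c ^+ 2)%:E.
Proof.
move=> ab; set P : plant R n := (_, _, _); set K := _ *: _.
have K0 : input P K 0 = c *: delta_mx a 0.
  by rewrite /input/= -scalemxAl mul_delta_mx.
have s1 : state P K 1 = (1 + e * c) *: delta_mx a 0.
  rewrite [LHS]/= -/(input P K 0) K0 mul_scalar_mx mul_delta_mx.
  by rewrite scalerA -[X in X + _]scale1r -scalerDl.
have A0 : delta_mx a b *m state P K 1 = 0.
  by rewrite s1 -scalemxAr mul_delta_mx_0 ?scaler0// eq_sym.
by rewrite cost_terminal -/P ?s1 ?K0 ?sqnorm_scale_delta// -s1 -?scalemxAl A0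
  ?scaler0.
Qed.

End SingleEdge.

Lemma diag_ge_scalar (R : realType) (n : nat) (e : R) :
  diag_ge e (e%:M : 'M[R]_n).
Proof.
by split=> [|i]; [exact: scalar_mx_is_diag | rewrite mxE eqxx mulr1n].
Qed.

Theorem theorem3p4 (R : realType) (q : nat) (hq : (1 <= q)%N)
    (n_ : 'I_q -> nat) (hn : forall i : 'I_q, (1 <= n_ i)%N)
    (eps : R) (heps : 0 < eps) (EP EK : digraph q)
    (hiso : forall i : 'I_q, ~~ isolated_vertex EP i)
    (hsub : EP \subset EK)
    (Kstar : plant R (\sum_(i < q) n_ i) -> 'M[R]_(\sum_(i < q) n_ i))
    (hKstar : forall P : plant R (\sum_(i < q) n_ i),
       plants n_ EP eps P -> optimal EK P (Kstar P)) :
  competitive_ratio Kstar (deadbeat n_ heps hsub) = (1 + 1 / eps ^+ 2)%:E.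
Proof.
set M := 1 + 1 / eps ^+ 2.
have M1 : 1 <= M by rewrite lerDl divr_ge0// sqr_ge0.
(* Deadbeat control is an admissible competitor of finite cost, so the optimal cost is finite and
   the ratio is one of reals. *)
have costs A B x0 : plants n_ EP eps (A, B, x0) ->
    exists d : R, [/\ cost (A, B, x0) (Kstar (A, B, x0)) = d%:E, 0 <= d
      & sqnorm (invmx B *m A *m x0) <= M * d].
  move=> hP; have [[/= hA hB] _] := hP; have [_ opt] := hKstar _ hP.
  have := opt _ (deadbeat_structured heps hsub hA hB).
  have := cost_deadbeat_le A x0 (Kstar (A, B, x0)) heps hB.
  have := cost_ge_first (A, B, x0) (Kstar (A, B, x0)).
  rewrite (cost_deadbeat _ _ heps hB).
  case: (cost _ _) => [d | |]//; rewrite -EFinM !lee_fin => h0 h1 _.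
  by exists d; split=> //; apply: le_trans h0; rewrite addr_ge0// sqnorm_ge0.
apply/eqP; rewrite eq_le; apply/andP; split.
  apply: ge_ereal_sup => _ [[[A B] x0] hP <-] /=.
  have [[/= _ hB] _] := hP; have [d [-> d0 hd]] := costs _ _ _ hP.
  by rewrite (cost_deadbeat _ _ heps hB) cost_ratio_le ?sqnorm_ge0.
(* The first vertex is not isolated; it may be either end of the edge. *)
have [i [j [ij jiE]]] : exists i j : 'I_q, i != j /\ (j, i) \in EP.
  have := hiso (Ordinal hq); rewrite negbK => /existsP[j /andP[j0]].
  by case/orP => ?; [exists j, (Ordinal hq) | exists (Ordinal hq), j];
    rewrite // eq_sym.
pose a := tagnat.Rank i (Ordinal (hn i)).
pose b := tagnat.Rank j (Ordinal (hn j)).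
have ab : a != b.
  apply: contra_neq ij => eab.
  by rewrite -(tagnat.Rank1K (Ordinal (hn i))) -/a eab tagnat.Rank1K.
have hB := @diag_ge_scalar R (\sum_(i < q) n_ i) eps.
pose P : plant R _ := (delta_mx a b, eps%:M, delta_mx b 0).
have hP : plants n_ EP eps P.
  split=> //; split=> //=.
  by rewrite -[delta_mx a b]scale1r; exact: structured_scale_delta.
(* [c] minimizes [(1 + eps c)^2 + c^2]. *)
pose c := - (eps / (1 + eps ^+ 2)).
have cK : structured n_ (adjmx EK) (c *: delta_mx a b).
  by apply: structured_scale_delta; exact: (fintype.subsetP hsub).
have [d [hd d0 _]] := costs _ _ _ hP.
have e2 : 0 < 1 + eps ^+ 2 by rewrite ltr_pwDl// sqr_ge0.
(* An upper bound on the optimal cost [d] bounds the ratio from below; the competitor costs $1 / (1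
   + eps^2)$. *)
have := (hKstar _ hP).2 _ cK; rewrite hd cost_single_edge// lee_fin => dle.
apply: (@le_trans _ _ (cost_ratio (cost P (deadbeat n_ heps hsub P.1.1 P.1.2))
                                  (cost P (Kstar P)))); last first.
  by apply: ereal_sup_ubound; exists P.
rewrite hd (cost_deadbeat _ _ heps hB) invmx_scalar mul_scalar_mx.
rewrite -scalemxAl mul_delta_mx sqnorm_scale_delta cost_ratio_ge//.
  by rewrite exprn_gt0// invr_gt0.
apply: (le_trans (ler_wpM2l _ dle)); first exact: le_trans M1.
(* Both sides equal $1 / eps^2$, the deadbeat cost. *)
rewrite le_eqVlt; apply/orP; left; apply/eqP; rewrite /M /c.
by field; rewrite !gt_eqF.
Qed.
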